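(* For any $n,\gamma\in\mathbb{N}$, any $d\in\{0,\ldots,n\}$ and any nodes $a=x_0<x_1<\dots<x_n=b$, the generalized Floater--Hormann interpolant preserves polynomials of degree at most $d$: $$\tilde r(f,x)=f(x),\qquad \forall x\in[a,b],\quad \forall f\in\mathbb{P}_d.$$
   Context: $\mathbb{N}=\{1,2,3,\ldots\}$; $\mathbb{P}_d$ is the set of all polynomials of degree at most $d$. Given nodes $a=x_0<x_1<\dots<x_n=b$, a function $f:[a,b]\to\mathbb{R}$, an integer $0\le d\le n$ and $\gamma\in\mathbb{N}$, for $i=0,\ldots,n-d$ let $p_i$ be the unique polynomial of degree $\le d$ interpolating $f$ at $x_i,x_{i+1},\ldots,x_{i+d}$, and let $$\tilde\lambda_i(x)=\frac{(-1)^{i\gamma}}{(x-x_i)^\gamma(x-x_{i+1})^\gamma\cdots(x-x_{i+d})^\gamma}.$$ The generalized Floater--Hormann interpolant of $f$ is $$\tilde r(f,x)=\frac{\sum_{i=0}^{n-d}\tilde\lambda_i(x)p_i(x)}{\sum_{i=0}^{n-d}\tilde\lambda_i(x)}.$$ Multiplying numerator and denominator by $(-1)^{\gamma(n-d)}\prod_{k=0}^n(x-x_k)^\gamma$, it is written as $$\tilde r(f,x)=\frac{\sum_{i=0}^{n-d}\tilde\mu_i(x)p_i(x)}{\sum_{i=0}^{n-d}\tilde\mu_i(x)},\qquad \tilde\mu_i(x)=\prod_{k=0}^{i-1}(x-x_k)^\gamma\prod_{k=i+d+1}^n(x_k-x)^\gamma,$$ with empty products equal to $1$; this form defines $\tilde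 r(f,x)$ also at the nodes. *)

(* Defs.v *)
From mathcomp Require Import all_boot all_order all_algebra.
From mathcomp Require Import boolp classical_sets reals.

Set Implicit Arguments.
Unset Strict Implicit.
Unset Printing Implicit Defensive.

Import Order.TTheory GRing.Theory Num.Theory.
Local Open Scope ring_scope.

Definition poly_on (R : realType) (a b : R) (d : nat) (f : R -> R) : Prop :=
  exists2 q : {poly R}, (size q <= d.+1)%N & {in `[a, b], f =1 horner q}.

Definition interpolates (R : realType) (n : nat) (x : 'I_n.+1 -> R)
    (f : R -> R) (d i : nat) (p : {poly R}) : Prop :=
  (size p <= d.+1)%N /\
  (forall j : 'I_n.+1, (i <= j <= i + d)%N -> p.[x j] = f (x j)).

(* The default value 0 is irrelevant for distinct nodes and i + d <= n: see
   [interpolates_exists_unique]. *)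
Definition local_interpolant (R : realType) (n : nat) (x : 'I_n.+1 -> R)
    (f : R -> R) (d i : nat) : {poly R} :=
  xget 0 [set p | interpolates x f d i p]%classic.

(* The lambda-weight (-1)^(i gamma) / prod_(i <= k <= i + d) (t - x k)^gamma
   multiplied by (-1)^(gamma (n - d)) prod_(0 <= k <= n) (t - x k)^gamma;
   unlike the former it also makes sense at the nodes. *)
Definition fh_weight (R : realType) (n : nat) (x : 'I_n.+1 -> R)
    (d gamma i : nat) (t : R) : R :=
  (\prod_(k < n.+1 | (k < i)%N) (t - x k) ^+ gamma) *
  (\prod_(k < n.+1 | (i + d < k)%N) (x k - t) ^+ gamma).

(* Division by zero yields 0, so fh_interpolant x d gamma f t = 1 for f = 1
   forces the denominator, which does not depend on f, to be nonzero at t. *)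
Definition fh_interpolant (R : realType) (n : nat) (x : 'I_n.+1 -> R)
    (d gamma : nat) (f : R -> R) (t : R) : R :=
  (\sum_(i < (n - d).+1)
     fh_weight x d gamma i t * (local_interpolant x f d i).[t]) /
  (\sum_(i < (n - d).+1) fh_weight x d gamma i t).

Lemma interpolates_exists_unique (R : realType) (n : nat) (x : 'I_n.+1 -> R)
    (f : R -> R) (d i : nat) :
  injective x -> (i + d <= n)%N ->
  exists! p : {poly R}, interpolates x f d i p.
Proof.
move=> x_inj le_n; pose y (j : 'I_d.+1) := x (inord (i + j)).
have lt_n (j : 'I_d.+1) : (i + j < n.+1)%N.
  by rewrite ltnS (leq_trans _ le_n) // leq_add2l -ltnS.
have y_inj : injective y.
  move=> j k /x_inj /(congr1 val) /=.
  by rewrite !inordK // => /addnI /val_inj.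
have yE (p : {poly R}) : interpolates x f d i p <->
    (size p <= d.+1)%N /\ forall j : 'I_d.+1, p.[y j] = f (y j).
  split=> -[sp pE]; split=> // j.
    by apply: pE; rewrite inordK // leq_addr leq_add2l -ltnS /=.
  move=> /andP[ij jid].
  have jd : (j - i < d.+1)%N by rewrite ltnS leq_subLR.
  by have := pE (Ordinal jd); rewrite /y /= subnKC // inord_val.
pose l (j : 'I_d.+1) : {poly R} := \prod_(k | k != j) ('X - (y k)%:P).
have size_l j : size (l j) = d.+1.
  rewrite /l -big_filter size_prod_XsubC; congr _.+1.
  transitivity #|predC1 j|; last by rewrite cardC1 card_ord.
  by rewrite cardE /enum_mem !size_filter.
have l0 j k : k != j -> (l j).[y k] = 0.
  by move=> kj; rewrite /l horner_prod (bigD1 k) //= !hornerE subrr mul0r.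
have l1 j : (l j).[y j] != 0.
  rewrite /l horner_prod; apply/prodf_neq0 => k kj.
  by rewrite !hornerE subr_eq0; apply: contra_neq kj => /y_inj ->.
pose q := \sum_(j < d.+1) (f (y j) / (l j).[y j]) *: l j.
have sq : (size q <= d.+1)%N.
  apply: (leq_trans (size_sum _ _ _)); apply/bigmax_leqP => j _.
  by rewrite (leq_trans (size_scale_leq _ _)) ?size_l.
have qE j : q.[y j] = f (y j).
  rewrite /q horner_sum (bigD1 j) //= big1 => [|k kj].
    by rewrite addr0 hornerZ divfK.
  have jk : j != k by rewrite eq_sym.
  by rewrite hornerZ (l0 _ _ jk) mulr0.
exists q; split; first exact/yE.
move=> p /yE[sp pE]; apply/eqP; rewrite -subr_eq0; apply/eqP.
apply: (@roots_geq_poly_eq0 _ _ (codom y)).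
- apply/allP => _ /codomP[j ->].
  by rewrite rootE hornerD hornerN qE pE subrr.
- by rewrite map_inj_uniq ?enum_uniq.
- rewrite size_codom card_ord (leq_trans (size_polyD _ _)) //.
  by rewrite size_polyN geq_max sq.
Qed.

(* Main.v *)
(** The denominator of the interpolant is positive on [[a, b]]. If gamma is even
    this is clear: all weights are nonnegative and they do not vanish
    simultaneously. If gamma is odd, let x_m be the last node with x_m <= t. The
    weights with m - d <= i <= m + 1 are nonnegative, and the one with
    i = max(0, m - d) is positive. On either side of this block, moving away from
    it, the weights alternate in sign and decrease in absolute value, so each of
    the two outer sums has the sign of its first, nonnegative, term.
    On the other hand, if f is a polynomial of degree at most d, then every local
    interpolant is f itself, and the quotient reduces to f t. *)
Require Import Defs.
From mathcomp Require Import all_boot all_order all_algebra.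
From mathcomp Require Import boolp classical_sets reals.
From mathcomp Require Import zify ring lra.

Set Implicit Arguments.
Unset Strict Implicit.
Unset Printing Implicit Defensive.

Import Order.TTheory GRing.Theory Num.Theory.
Local Open Scope ring_scope.

(** By induction the tail is [c * u 1 = - (c * r * u 0)], so the whole sum is [(1 - c * r) * u 0],
    and [r < 1] keeps this factor positive. A multiple of [u 0] is stated rather than a sign because
    the sign of the first term flips when passing to the tail. *)
Lemma alternating_sumE (R : realFieldType) (N : nat) (u : nat -> R) :
  (forall i, (i < N)%N -> exists2 r, 0 <= r < 1 & u i.+1 = - (r * u i)) ->
  exists2 c, 0 < c <= 1 & \sum_(0 <= i < N.+1) u i = c * u 0%N.
Proof.
elim: N u => [|N IHN] u u_alt.
  by exists 1; rewrite ?ltr01 ?lexx // big_nat1 mul1r.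
have [i iN|c /andP[c0 c1] cE] := IHN (fun i => u i.+1); first exact: u_alt.
have [r /andP[r0 r1] rE] := u_alt 0%N isT.
exists (1 - c * r); first by apply/andP; split; nra.
by rewrite big_nat_recl //= cE rE; ring.
Qed.

Lemma exprn_ratio_bounds (R : realFieldType) (n : nat) (u v : R) :
  (0 < n)%N -> 0 <= u < v -> 0 <= (u / v) ^+ n < 1.
Proof.
move=> n0 /andP[u0 uv]; have v0 : 0 < v by exact: le_lt_trans uv.
have uv0 : 0 <= u / v by rewrite divr_ge0 // ltW.
by rewrite exprn_ge0 //= exprn_ilt1 -?lt0n // ltr_pdivrMr // mul1r.
Qed.

Lemma exprNn_odd (R : pzRingType) (n : nat) (u : R) :
  odd n -> (- u) ^+ n = - u ^+ n.
Proof. by move=> n_odd; rewrite exprNn -signr_odd n_odd mulN1r. Qed.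

Section Weights.

Variables (R : realType) (n : nat) (x : 'I_n.+1 -> R) (d gamma : nat) (t : R).

Local Notation w i := (fh_weight x d gamma i t).

(** Passing from [i] to [i.+1] only gains the factor of [x i] and loses that of [x j]. The
    cross-multiplied form stays valid when [t] is a node. *)
Lemma fh_weightS (i j : 'I_n.+1) : j = (i + d).+1 :> nat ->
  w i.+1 * (x j - t) ^+ gamma = w i * (t - x i) ^+ gamma.
Proof.
move=> jE; rewrite /fh_weight.
rewrite (bigD1 i) //= [in RHS]mulrC [X in _ = _ * (_ * X)](bigD1 j) /=; last first.
  by rewrite jE.
rewrite (eq_bigl (fun k : 'I_n.+1 => (k < i)%N)); last first.
  by move=> k; rewrite -val_eqE /=; lia.
rewrite [X in _ * X * _ = _](eq_bigl
  (fun k : 'I_n.+1 => (i + d < k)%N && (k != j))); last first.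
  by move=> k; rewrite -val_eqE /=; lia.
ring.
Qed.

Lemma fh_weight_ge0 (i : nat) :
  (forall k : 'I_n.+1, (k < i)%N -> x k <= t) ->
  (forall k : 'I_n.+1, (i + d < k)%N -> t <= x k) -> 0 <= w i.
Proof.
move=> lo hi; apply: mulr_ge0; apply: prodr_ge0 => k ki;
  by rewrite exprn_ge0 // subr_ge0 (lo, hi).
Qed.

Lemma fh_weight_gt0 (i : nat) :
  (forall k : 'I_n.+1, (k < i)%N -> x k < t) ->
  (forall k : 'I_n.+1, (i + d < k)%N -> t < x k) -> 0 < w i.
Proof.
move=> lo hi; apply: mulr_gt0; apply: prodr_gt0 => k ki;
  by rewrite exprn_gt0 // subr_gt0 (lo, hi).
Qed.

Lemma fh_weight_ge0_even (i : nat) : ~~ odd gamma -> 0 <= w i.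
Proof.
by move=> g_even; apply: mulr_ge0; apply: prodr_ge0 => k _; exact: exprn_even_ge0.
Qed.

Hypothesis x_incr : forall i j : 'I_n.+1, (i < j)%N -> x i < x j.
Hypothesis gamma_odd : odd gamma.

Lemma fh_weight_alt_right (i : nat) : ((i + d).+1 <= n)%N -> t < x (inord i) ->
  exists2 r, 0 <= r < 1 & w i.+1 = - (r * w i).
Proof.
move=> idn ti; pose i' : 'I_n.+1 := inord i; pose j : 'I_n.+1 := inord (i + d).+1.
have i'E : i' = i :> nat by rewrite inordK //; lia.
have jE : j = (i' + d).+1 :> nat by rewrite i'E inordK.
have xij : x i' < x j by apply: x_incr; lia.
(* The ratio of consecutive weights given by [fh_weightS]; the minus sign comes from
   [t - x i' = - (x i' - t)] raised to an odd power. *)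
exists (((x i' - t) / (x j - t)) ^+ gamma).
  by apply: exprn_ratio_bounds; [exact: odd_gt0|rewrite subr_ge0 ltW //= ltrD2r].
have xj0 : (x j - t) ^+ gamma != 0.
  by rewrite expf_neq0 // subr_eq0 gt_eqF // (lt_trans ti).
apply: (mulIf xj0); have := fh_weightS jE; rewrite i'E => ->.
rewrite -[t - _]opprB exprNn_odd // expr_div_n; field.
by move: xj0.
Qed.

Lemma fh_weight_alt_left (i : nat) : ((i + d).+1 <= n)%N ->
  x (inord (i + d).+1) <= t ->
  exists2 r, 0 <= r < 1 & w i = - (r * w i.+1).
Proof.
move=> idn jt; pose i' : 'I_n.+1 := inord i; pose j : 'I_n.+1 := inord (i + d).+1.
have i'E : i' = i :> nat by rewrite inordK //; lia.
have jE : j = (i' + d).+1 :> nat by rewrite i'E inordK.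
have xij : x i' < x j by apply: x_incr; lia.
(* The inverse ratio, now that both nodes lie left of [t] or [x j = t]; in the latter case
   [r = 0]. *)
exists (((t - x j) / (t - x i')) ^+ gamma).
  apply: exprn_ratio_bounds; first exact: odd_gt0.
  by rewrite subr_ge0 jt ltrD2l ltrN2.
have xi0 : (t - x i') ^+ gamma != 0.
  by rewrite expf_neq0 // subr_eq0 gt_eqF // (lt_le_trans xij).
apply: (mulIf xi0); have := fh_weightS jE; rewrite i'E => <-.
rewrite -[x j - _]opprB exprNn_odd // expr_div_n; field.
by move: xi0.
Qed.

End Weights.

Lemma fh_denominator_gt0 (R : realType) (n : nat) (x : 'I_n.+1 -> R)
    (d gamma : nat) (t : R) :
  (d <= n)%N -> (forall i j : 'I_n.+1, (i < j)%N -> x i < x j) -> x ord0 <= t ->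
  0 < \sum_(i < (n - d).+1) fh_weight x d gamma i t.
Proof.
move=> dn x_incr x0t.
have [m mt m_max] := @arg_maxnP _ ord0 (fun k => x k <= t) (@nat_of_ord n.+1) x0t.
have m_lt (k : 'I_n.+1) : (m < k)%N -> t < x k.
  by move=> mk; rewrite ltNge; apply/negP => /m_max /=; lia.
have lt_m (k : 'I_n.+1) : (k < m)%N -> x k < t.
  by move=> km; exact: lt_le_trans (x_incr _ _ km) mt.
have le_m (k : 'I_n.+1) : (k <= m)%N -> x k <= t.
  by rewrite leq_eqVlt => /orP[/eqP/val_inj-> //|/lt_m/ltW].
have mn := ltn_ord m.
pose w i := fh_weight x d gamma i t.
(* Truncated subtraction makes [m - d] the index max(0, m - d). *)
have w0 : 0 < w (m - d)%N by apply: fh_weight_gt0 => k ki; [apply: lt_m|apply: m_lt]; lia.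
case: (boolP (odd gamma)) => [g_odd|g_even]; last first.
  have lt_md : (m - d < (n - d).+1)%N by lia.
  rewrite (bigD1 (Ordinal lt_md)) //= ltr_wpDr // sumr_ge0 // => i _.
  exact: fh_weight_ge0_even.
rewrite -(big_mkord xpredT w).
rewrite (@big_cat_nat _ _ _ (m - d).+1) //=; last by lia.
rewrite ltr_wpDr //; last first.
  (* The left sum is read backwards, so that it starts at the positive weight [w (m - d)] and
     decreases in absolute value. *)
  rewrite big_nat_rev /=.
  have [i ilt|c /andP[c0 _] ->] :=
      @alternating_sumE R (m - d) (fun i => w (0 + (m - d).+1 - i.+1)%N).
    have -> : (0 + (m - d).+1 - i.+1 = (m - d - i.+1).+1)%N by lia.
    have -> : (0 + (m - d).+1 - i.+2 = m - d - i.+1)%N by lia.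
    apply: fh_weight_alt_left => //; first by lia.
    by apply: le_m; rewrite inordK; lia.
  by rewrite mulr_gt0 // add0n subn1.
(* If [n - d <= m], all remaining indices lie in the nonnegative block and there is no right outer
   sum. *)
have [le_nm|lt_mn] := leqP (n - d) m.
  rewrite big_nat_cond sumr_ge0 // => i; rewrite andbT => /andP[mi iN].
  by apply: fh_weight_ge0 => k ki; apply: ltW; [apply: lt_m|apply: m_lt]; lia.
rewrite (@big_cat_nat _ _ _ m.+1) //=; [|lia|lia].
rewrite addr_ge0 //.
  rewrite big_nat_cond sumr_ge0 // => i; rewrite andbT => /andP[mi iN].
  by apply: fh_weight_ge0 => k ki; apply: ltW; [apply: lt_m|apply: m_lt]; lia.
rewrite -[X in index_iota X _]add0n big_addn.
have -> : ((n - d).+1 - m.+1 = (n - d - m.+1).+1)%N by lia.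
have [i ilt|c /andP[c0 _] ->] :=
    @alternating_sumE R (n - d - m.+1) (fun i => w (i + m.+1)%N).
  rewrite addSn; apply: fh_weight_alt_right => //; first by lia.
  by apply: m_lt; rewrite inordK; lia.
(* The first term [w m.+1] is only nonnegative: it vanishes when [t = x m]. *)
rewrite mulr_ge0 ?(ltW c0) // add0n.
by apply: fh_weight_ge0 => k ki; [apply: le_m|apply/ltW/m_lt]; lia.
Qed.

Lemma local_interpolantE (R : realType) (n : nat) (x : 'I_n.+1 -> R)
    (f : R -> R) (d i : nat) (p : {poly R}) :
  injective x -> (i + d <= n)%N -> interpolates x f d i p ->
  local_interpolant x f d i = p.
Proof.
move=> x_inj idn pP; rewrite /local_interpolant.
have [q [_ q_uniq]] := interpolates_exists_unique f x_inj idn.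
by case: xgetP => [r _ rP|/(_ p)//]; rewrite -(q_uniq r) // -(q_uniq p).
Qed.

Theorem mainTheorem3 (R : realType) (n gamma d : nat) (a b : R)
    (x : 'I_n.+1 -> R)
    (n_gt0 : (0 < n)%N) (gamma_gt0 : (0 < gamma)%N) (le_dn : (d <= n)%N)
    (x_first : x ord0 = a) (x_last : x ord_max = b)
    (x_incr : forall i j : 'I_n.+1, (i < j)%N -> x i < x j) :
  forall t : R, a <= t <= b ->
  forall f : R -> R, poly_on a b d f ->
  fh_interpolant x d gamma f t = f t.
Proof.
move=> t tab f [q sq fE].
have x_le (i j : 'I_n.+1) : (i <= j)%N -> x i <= x j.
  by rewrite leq_eqVlt => /orP[/eqP/val_inj-> //|/x_incr/ltW].
have x_inj : injective x.
  move=> i j xij; apply: val_inj; apply/eqP.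
  by case: ltngtP => // /x_incr; rewrite xij ltxx.
(* Since [f] agrees with [q] only on [a, b], the nodes have to be placed in that interval. *)
have qP i : interpolates x f d i q.
  split=> // j _; rewrite fE // in_itv /= -x_first -x_last !x_le //.
  by rewrite /= -ltnS.
rewrite /fh_interpolant.
under eq_bigr => i _.
  have idn : (i + d <= n)%N by have := ltn_ord i; lia.
  rewrite (local_interpolantE x_inj idn (qP i)); over.
rewrite -mulr_suml mulrC mulKf ?fE ?in_itv //.
apply/lt0r_neq0/fh_denominator_gt0 => //.
by rewrite x_first; case/andP: tab.
Qed.
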